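(* Let $(X_t)_{t\in\mathbb{Z}}$ be a centered strictly stationary process with finite second moments satisfying $X_t-\phi X_{t-1}=Z_t$ for every $t\in\mathbb{Z}$, where $\phi=e^{-H}$ for some $H>0$ and $(Z_t)_{t\in\mathbb{Z}}$ is a strictly stationary process. Let $\gamma(n)=\operatorname{cov}(X_t,X_{t+n})$, $r(n)=\operatorname{cov}(Z_t,Z_{t+n})$, and let $N\in\mathbb{N}$ be fixed. Put $$g(x_1,x_2,x_3)=(x_1+x_3)^2-4x_2(x_2-r(N)),\qquad \boldsymbol{\gamma}=[\gamma(N+1),\gamma(N),\gamma(N-1)]^\top,$$ and let $\hat{\boldsymbol{\gamma}}_T=[\hat\gamma_T(N+1),\hat\gamma_T(N),\hat\gamma_T(N-1)]^\top$ be an estimator of $\boldsymbol{\gamma}$ based on observations $(X_1,\ldots,X_T)$. Define $\hat\phi_T$ as the truncation to $[0,1]$ of $$\frac{\hat\gamma_T(N+1)+\hat\gamma_T(N-1)+\sqrt{g(\hat{\boldsymbol{\gamma}}_T)}\,\mathbf{1}_{\{g(\hat{\boldsymbol{\gamma}}_T)>0\}}}{2\hat\gamma_T(N)}\,\mathbf{1}_{\{\hat\gamma_T(N)\neq0\}}.$$ Assume that $\gamma(N)\neq0$ and $g(\boldsymbol{\gamma})>0$. Furthermore, assume that $\phi$ is given by $$\phi=\frac{\gamma(N+1)+\gamma(N-1)+\sqrt{g(\boldsymbol{\gamma})}}{2\gamma(N)}.$$ If $\hat{\boldsymbol{\gamma}}_T$ is consistent (for $\boldsymbol{\gamma}$),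 then $\hat\phi_T$ is consistent (for $\phi$).
   Context: All processes are real-valued. A process $X=(X_t)_{t\in\mathbb{Z}}$ is strictly stationary if $(X_{t+n_1},\ldots,X_{t+n_k})$ and $(X_{n_1},\ldots,X_{n_k})$ have the same law for all $k\in\mathbb{N}$ and $t,n_1,\ldots,n_k\in\mathbb{Z}$. Centered means $\mathbb{E}(X_t)=0$ for every $t$. Consistency means convergence in probability to the true value as $T\to\infty$. The truncation to $[0,1]$ of a real number $y$ is $y$ if $y\in[0,1]$, $0$ if $y<0$, and $1$ if $y>1$. Terms multiplied by an indicator are $0$ when the indicator is $0$. The estimators $\hat\gamma_T(n)$ are arbitrary real-valued random variables (functions of the observations); no specific form is assumed. *)

(* Defs.v *)
From HB Require Import structures.
From mathcomp Require Import all_boot all_order all_algebra.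
From mathcomp Require Import all_classical all_reals all_analysis.
From mathcomp Require Import measurable_realfun.

Set Implicit Arguments.
Unset Strict Implicit.
Unset Printing Implicit Defensive.

Import Order.TTheory GRing.Theory Num.Theory.
Import numFieldNormedType.Exports.

Local Open Scope classical_set_scope.
Local Open Scope ring_scope.

Section processes.
Context {d : measure_display} {Omega : measurableType d} {R : realType}.
Context (P : probability Omega R).

Definition process : Type := int -> {RV P >-> R}.

Definition random_vector (X : process) (k : nat) (s : 'I_k -> int)
  : Omega -> k.-tuple R := fun w => [tuple X (s i) w | i < k].

Lemma measurable_random_vector (X : process) k (s : 'I_k -> int) :
  measurable_fun [set: Omega] (random_vector X s).
Proof.
apply/measurable_fun_tnthP => i.
rewrite (_ : _ \o _ = X (s i)); first exact: measurable_funPT.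
by apply/funext => w /=; rewrite tnth_mktuple.
Qed.

HB.instance Definition _ (X : process) k (s : 'I_k -> int) :=
  isMeasurableFun.Build _ _ _ _ (random_vector X s)
    (measurable_random_vector X s).

(* [distribution] is defined on arbitrary sets, but the law of a random
   element only consists of its values on measurable sets. *)
Definition same_law {d'} {E : measurableType d'} (U V : {RV P >-> E}) : Prop :=
  forall A : set E, measurable A -> distribution P U A = distribution P V A.

Definition strictly_stationary (X : process) : Prop :=
  forall (k : nat) (t : int) (n : 'I_k -> int),
    same_law (random_vector X (fun i => t + n i)) (random_vector X n).

Definition centered (X : process) : Prop := forall t, ('E_P[X t] = 0)%E.

Definition finite_second_moments (X : process) : Prop :=
  forall t, (X t : Omega -> R) \in Lfun P 2%:E.

(* For a strictly stationary process the time origin is irrelevant, see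
   [autocovE] below. *)
Definition autocov (X : process) (n : int) : R :=
  fine (covariance P (X 0) (X n)).

Definition based_on_observations (X : process) (T : nat) (Y : Omega -> R) :
    Prop :=
  exists f : T.-tuple R -> R,
    forall w, Y w = f (random_vector X (fun i : 'I_T => (i.+1)%:Z) w).

(* On column vectors [`|_|] is the sup norm, so that vector-valued convergence
   is the same as for the Euclidean norm, or as componentwise convergence. *)
Definition cvg_in_probability {V : normedZmodType R} (Y : nat -> Omega -> V)
    (c : V) : Prop :=
  forall eps : R, 0 < eps ->
    P [set w | eps < `|Y T w - c|] @[T --> \oo] --> 0%E.

Lemma same_law_integral {d'} {E : measurableType d'} (U V : {RV P >-> E})
    (h : E -> \bar R) : measurable_fun [set: E] h -> same_law U V ->
  (\int[P]_w (h \o U) w = \int[P]_w (h \o V) w)%E.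
Proof.
move=> mh UV; rewrite integralE [RHS]integralE.
have ge0 (h' : E -> \bar R) : measurable_fun [set: E] h' ->
    (forall y, 0 <= h' y)%E ->
    (\int[P]_w (h' \o U) w = \int[P]_w (h' \o V) w)%E.
  move=> mh' h0; rewrite -!ge0_integral_distribution//.
  by apply: eq_measure_integral => A mA _; exact: UV.
congr (_ - _)%E.
- have := ge0 (h^\+)%E (measurable_funepos mh) (funepos_ge0 h).
  by rewrite funepos.unlock.
- have := ge0 (h^\-)%E (measurable_funeneg mh) (funeneg_ge0 h).
  by rewrite funeneg.unlock.
Qed.

Lemma autocovE (X : process) (t n : int) : strictly_stationary X ->
  fine (covariance P (X t) (X (t + n))) = autocov X n.
Proof.
move=> sX; congr fine.
have law2 (m : int) (h : 2.-tuple R -> R) : measurable_fun [set: 2.-tuple R] h ->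
    expectation P (fun w => h [tuple X t w; X (t + m) w]) =
      expectation P (fun w => h [tuple X 0 w; X m w]).
  move=> mh; rewrite expectation.unlock.
  pose s (i : 'I_2) : int := if val i == 0%N then 0 else m.
  have mh' : measurable_fun [set: 2.-tuple R] (EFin \o h).
    exact: measurableT_comp.
  have tE : (fun w => (h [tuple X t w; X (t + m) w])%:E) =
      (EFin \o h) \o random_vector X (fun i => t + s i).
    apply/funext => w /=; congr (h _)%:E; apply: eq_from_tnth => i.
    rewrite tnth_mktuple /s.
    by case: i => -[|[|//]] //= ?; rewrite /tnth /= ?addr0.
  have sE : (fun w => (h [tuple X 0 w; X m w])%:E) =
      (EFin \o h) \o random_vector X s.
    apply/funext => w /=; congr (h _)%:E; apply: eq_from_tnth => i.
    rewrite tnth_mktuple /s.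
    by case: i => -[|[|//]] //= ?; rewrite /tnth /=.
  by rewrite tE sE; exact: same_law_integral mh' (sX 2%N t s).
have E0 : expectation P (X t) = expectation P (X 0).
  exact: (law2 0 (fun v => tnth v ord0) (measurable_tnth _)).
have En : expectation P (X (t + n)) = expectation P (X n).
  exact: (law2 n (fun v => tnth v (lift ord0 ord0)) (measurable_tnth _)).
rewrite covariance.unlock E0 En.
apply: (law2 n (fun v => (tnth v ord0 - fine (expectation P (X 0))) *
  (tnth v (lift ord0 ord0) - fine (expectation P (X n))))).
by apply: measurable_funM; apply: measurable_funB => //; exact: measurable_tnth.
Qed.

End processes.

Definition trunc01 {R : realType} (y : R) : R :=
  if y < 0 then 0 else if 1 < y then 1 else y.

Definition vec3 {R : realType} (x1 x2 x3 : R) : 'cV[R]_3 :=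
  \col_i [:: x1; x2; x3]`_i.

(* [rN] stands for [r(N)]. *)
Definition g_fun {R : realType} (rN x1 x2 x3 : R) : R :=
  (x1 + x3) ^+ 2 - 4 * x2 * (x2 - rN).

Definition phi_est {R : realType} (rN x1 x2 x3 : R) : R :=
  trunc01
    (if x2 != 0 then
       (x1 + x3 + (if 0 < g_fun rN x1 x2 x3
                   then Num.sqrt (g_fun rN x1 x2 x3) else 0)) / (2 * x2)
     else 0).

(* Main.v *)
(* Continuous mapping theorem: with the convention x / 0 = 0, phi_est is
   measurable and is continuous wherever its middle argument is nonzero, and its
   value at the true autocovariances is phi, because phi = exp (- H) lies in
   [0, 1] and is thus fixed by the truncation. *)

Require Import Defs.
From HB Require Import structures.
From mathcomp Require Import all_boot all_order all_algebra.
From mathcomp Require Import all_classical all_reals all_analysis.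
From mathcomp Require Import measurable_realfun.

Set Implicit Arguments.
Unset Strict Implicit.
Unset Printing Implicit Defensive.

Import Order.TTheory GRing.Theory Num.Theory.
Import numFieldNormedType.Exports.

Local Open Scope classical_set_scope.
Local Open Scope ring_scope.

(** Inversion is reduced to a real power through x^-1 = x * (x^2)^(-1). Squaring makes the base
    nonnegative, as [powR_inv1] requires, and at x = 0 both sides vanish. *)
Lemma measurable_fun_inv (d : measure_display) (T : measurableType d)
  (R : realType) (D : set T) (f : T -> R) :
  measurable_fun D f -> measurable_fun D (fun x => (f x)^-1).
Proof.
move=> mf.
have invE (x : R) : x^-1 = x * (x ^+ 2) `^ (-1).
  rewrite powR_inv1 ?sqr_ge0// expr2 invfM mulrA.
  by have [->|x0] := eqVneq x 0; rewrite ?invr0 ?mulr0// divff// mul1r.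
under eq_fun do rewrite invE.
apply: measurable_funM => //.
by apply: (measurableT_comp (measurable_powR _)); exact: measurable_funX.
Qed.

(** The sup norm is a finite maximum of absolute values of entries, so induction on the list of
    indices suffices. *)
Lemma measurable_mx_norm (d : measure_display) (T : measurableType d)
  (R : realType) (m n : nat) (M : T -> 'M[R]_(m, n)) :
  (forall i j, measurable_fun setT (fun x => M x i j)) ->
  measurable_fun setT (fun x => `|M x|).
Proof.
move=> mM.
have -> : (fun x => `|M x|) =
    fun x => \big[Num.max/0]_ij `|M x ij.1 ij.2|.
  by apply/funext => x; rewrite [LHS]mx_normrE.
move: (index_enum _); elim => [|[i j] s ih].
  by under eq_fun do rewrite big_nil; exact: measurable_cst.
under eq_fun do rewrite big_cons.
by apply: measurable_maxr => //=; apply: measurableT_comp (mM i j).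
Qed.

(** Since the limit [c] is constant, continuity at [c] alone puts the event of a large deviation of
    [h (Y T)] inside one for [Y T]. As [V] and [W] carry no sigma-algebra, measurability is asked of
    the norms, which is what monotonicity of [P] uses. *)
Lemma cvg_in_probability_comp (d : measure_display) (Omega : measurableType d)
  (R : realType) (P : probability Omega R) (V W : normedModType R)
  (h : V -> W) (Y : nat -> Omega -> V) (c : V) :
  {for c, continuous h} ->
  (forall T, measurable_fun setT (fun w => `|Y T w - c|)) ->
  (forall T, measurable_fun setT (fun w => `|h (Y T w) - h c|)) ->
  cvg_in_probability P Y c ->
  cvg_in_probability P (fun T w => h (Y T w)) (h c).
Proof.
move=> hc mY mhY Yc eps eps0.
have : \forall v \near c, `|h v - h c| <= eps by exact: cvgr_distC_le.
move=> /nbhs_ballP[delta /= delta0 hdelta].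
(* Halving [delta] turns the non-strict bound off the deviation event into the strict one that
   defines the ball. *)
have delta20 : 0 < delta / 2 by rewrite divr_gt0.
have measurable_gt (f : Omega -> R) (e : R) :
    measurable_fun setT f -> measurable [set w | e < f w].
  move=> mf; rewrite -[X in measurable X]setTI.
  have := mf measurableT _ (measurable_itv `]e, +oo[).
  by rewrite preimage_itvoy.
apply: squeeze_cvge (cvg_cst 0%E) (Yc _ delta20).
apply: nearW => T; rewrite measure_ge0/=.
apply: le_measure; rewrite ?inE; [exact: measurable_gt..|].
move=> w /=; rewrite !ltNge; apply: contra => Yw.
apply: (hdelta (Y T w)); rewrite -ball_normE /= distrC (le_lt_trans Yw)//.
by rewrite gtr_pMr// invf_lt1// ltr1n.
Qed.

(** The lattice form replaces case splits by the measurability and continuity of [max] and [min]. *)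
Lemma trunc01E (R : realType) (y : R) : trunc01 y = Num.max 0 (Num.min 1 y).
Proof.
rewrite /trunc01; have [y0|y0] := ltP y 0.
  rewrite min_r; last by rewrite ltW// (lt_trans y0).
  by rewrite max_l// ltW.
by have [y1|y1] := ltP 1 y; rewrite max_r.
Qed.

(* Both indicators are redundant under the conventions x / 0 = 0 and
   sqrt x = 0 for x < 0. *)
Lemma phi_estE (R : realType) (rN x1 x2 x3 : R) :
  phi_est rN x1 x2 x3 =
    Num.max 0 (Num.min 1
      ((x1 + x3 + Num.sqrt (g_fun rN x1 x2 x3)) / (2 * x2))).
Proof.
rewrite /phi_est trunc01E; congr (Num.max 0 (Num.min 1 _)).
have [->|_] /= := eqVneq x2 0; first by rewrite mulr0 invr0 mulr0.
by case: ltP => // g0; rewrite ler0_sqrtr.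
Qed.

Lemma measurable_phi_est (d : measure_display) (T : measurableType d)
  (R : realType) (rN : R) (f1 f2 f3 : T -> R) :
  measurable_fun setT f1 -> measurable_fun setT f2 -> measurable_fun setT f3 ->
  measurable_fun setT (fun x => phi_est rN (f1 x) (f2 x) (f3 x)).
Proof.
move=> m1 m2 m3; under eq_fun do rewrite phi_estE.
apply: measurable_maxr => //; apply: measurable_minr => //.
apply: measurable_funM; last first.
  by apply: measurable_fun_inv; exact: measurable_funM.
apply: measurable_funD; first exact: measurable_funD.
apply: (measurableT_comp (continuous_measurable_fun (@sqrt_continuous R))).
apply: measurable_funB.
  by apply: measurable_funX; exact: measurable_funD.
by apply: measurable_funM; [exact: measurable_funM|exact: measurable_funB].
Qed.

(** The square root, extended by 0 to negative numbers, is continuous on the whole line; only the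
    division restricts the point. *)
Lemma continuous_phi_est (T : topologicalType) (R : realType) (rN : R)
  (f1 f2 f3 : T -> R) (x : T) :
  {for x, continuous f1} -> {for x, continuous f2} -> {for x, continuous f3} ->
  f2 x != 0 ->
  {for x, continuous (fun y => phi_est rN (f1 y) (f2 y) (f3 y))}.
Proof.
move=> c1 c2 c3 x2; rewrite (funext (fun y => phi_estE _ _ _ _)).
apply: continuous_max; first exact: cvg_cst.
apply: continuous_min; first exact: cvg_cst.
apply: cvgM; last first.
  by apply: cvgV; [rewrite mulf_neq0|apply: cvgM => //; exact: cvg_cst].
apply: cvgD; first exact: cvgD.
apply: continuous_comp; last exact: sqrt_continuous.
apply: cvgB; first by apply: cvgM; exact: cvgD.
by apply: cvgM; [apply: cvgM => //; exact: cvg_cst|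
  apply: cvgB => //; exact: cvg_cst].
Qed.

Theorem theorem5 (d : measure_display) (Omega : measurableType d)
  (R : realType) (P : probability Omega R)
  (X Z : process P) (H phi : R) (N : nat)
  (gamma_hat : nat -> int -> {RV P >-> R}) :
  let gamma := autocov X in
  let r := autocov Z in
  let n1 := N%:Z + 1 in
  let n2 := N%:Z in
  let n3 := N%:Z - 1 in
  let g := g_fun (r N%:Z) in
  let phi_hat T w :=
    phi_est (r N%:Z) (gamma_hat T n1 w) (gamma_hat T n2 w) (gamma_hat T n3 w) in
  strictly_stationary X -> centered X -> finite_second_moments X ->
  strictly_stationary Z ->
  0 < H -> phi = expR (- H) ->
  (forall t : int, \forall w \ae P, X t w - phi * X (t - 1) w = Z t w) ->
  (forall T n, based_on_observations X T (gamma_hat T n)) ->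
  gamma n2 != 0 ->
  0 < g (gamma n1) (gamma n2) (gamma n3) ->
  phi = (gamma n1 + gamma n3 + Num.sqrt (g (gamma n1) (gamma n2) (gamma n3)))
          / (2 * gamma n2) ->
  cvg_in_probability P
    (fun T w => vec3 (gamma_hat T n1 w) (gamma_hat T n2 w) (gamma_hat T n3 w))
    (vec3 (gamma n1) (gamma n2) (gamma n3)) ->
  cvg_in_probability P phi_hat phi.
Proof.
move=> gamma r n1 n2 n3 g phi_hat _ _ _ _ H0 phiH _ _ gamma0 _ phiE gamma_hatP.
(* The estimator becomes a single function of a column vector; [lift 0 1] is the third row index. *)
pose h (v : 'cV[R]_3) :=
  phi_est (r N%:Z) (v 0 0) (v 1 0) (v (lift 0 1) 0).
have hE x1 x2 x3 : h (vec3 x1 x2 x3) = phi_est (r N%:Z) x1 x2 x3.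
  by rewrite /h !mxE.
have phi01 : 0 <= phi <= 1.
  by rewrite phiH expR_ge0 -expR0 ler_expR oppr_le0 ltW.
have hphi : h (vec3 (gamma n1) (gamma n2) (gamma n3)) = phi.
  case/andP: phi01 => phi0 phi1.
  by rewrite hE phi_estE -/(g _ _ _) -phiE min_r// max_r.
have -> : phi_hat = fun T w =>
    h (vec3 (gamma_hat T n1 w) (gamma_hat T n2 w) (gamma_hat T n3 w)).
  by apply/funext => T; apply/funext => w; rewrite hE.
rewrite -[in X in cvg_in_probability _ _ X]hphi.
apply: cvg_in_probability_comp gamma_hatP.
(* The middle entry of the limit vector is [gamma n2], nonzero by [gamma0]. *)
- by apply: continuous_phi_est; [exact: coord_continuous..|rewrite mxE].
- move=> T; apply: measurable_mx_norm => i j.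
  under eq_fun do rewrite !mxE.
  apply: measurable_funB => //.
  by case: i => -[|[|[|//]]].
- move=> T; under eq_fun do rewrite hE.
  apply: measurableT_comp => //; apply: measurable_funB => //.
  exact: measurable_phi_est.
Qed.
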